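(* Let $W=\{w_1,\dots,w_n\}$ be a family of spherical circle radii, i.e. real numbers with $0\le w_i<\pi/2$ (repetitions allowed). Then there exist points $p_1,\dots,p_n$ on the unit sphere $S^2$ such that the spherical Laguerre Voronoi diagram $\mathcal{L}=\{L_1,\dots,L_n\}$ generated by the spherical circles $\tilde c_1,\dots,\tilde c_n$, where $\tilde c_i$ has center $p_i$ and radius $w_i$, satisfies the non-emptiness property: $L_i\neq\emptyset$ for all $i=1,\dots,n$.
   Context: $S^2\subset\mathbb{R}^3$ is the unit sphere centered at the origin, with geodesic distance $\tilde d(p,q)=\arccos(p\cdot q)\in[0,\pi]$. The spherical circle with center $q\in S^2$ and radius $w\in[0,\pi/2)$ is $\{p\in S^2:\tilde d(p,q)\le w\}$. For a spherical circle $\tilde c_i$ with center $p_i$ and radius (weight) $w_i$, the Laguerre proximity of $p\in S^2$ to $\tilde c_i$ is $$\tilde d_L(\tilde c_i,p)=\frac{\cos(\tilde d(p,p_i))}{\cos(w_i)}=\frac{p\cdot p_i}{\cos w_i},$$ a larger value meaning that $p$ is closer to $\tilde c_i$. The spherical Laguerre Voronoi diagram generated by $\tilde c_1,\dots,\tilde c_n$ is the collection of cells $$L_i=\{p\in S^2:\ \tilde d_L(\tilde c_i,p)>\tilde d_L(\tilde c_j,p)\ \text{for all } j\neq i\},\qquad i=1,\dots,n.$$ (Equivalently, the diagram is the central projection onto $S^2$ of the boundary of the intersection of the half-spaces containing the origin bounded by the planes through the circles.) *)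

(* Defs.v *)
From HB Require Import structures.
From mathcomp Require Import all_boot all_order all_algebra.
From mathcomp Require Import all_classical all_reals all_analysis.

Set Implicit Arguments.
Unset Strict Implicit.
Unset Printing Implicit Defensive.

Import Order.TTheory GRing.Theory Num.Theory.
Local Open Scope classical_set_scope.
Local Open Scope ring_scope.

Definition dot {R : realType} (u v : 'rV[R]_3) : R :=
  \sum_(k < 3) u 0 k * v 0 k.

Definition sphere2 {R : realType} : set 'rV[R]_3 := [set p | dot p p = 1].

Definition geodist {R : realType} (p q : 'rV[R]_3) : R := acos (dot p q).

(* A spherical circle is represented by its centre and its angular radius,
   which determine the set [set p | sphere2 p /\ geodist p center <= radius]
   and are determined by it. *)
Record scircle (R : realType) := SCircle {
  center : 'rV[R]_3;
  radius : R;
  center_sphere2 : sphere2 center;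
  radius_bounds : 0 <= radius < pi / 2
}.

Arguments SCircle {R} center radius center_sphere2 radius_bounds.

(* A larger value means that p is closer to c. *)
Definition laguerre_prox {R : realType} (c : scircle R) (p : 'rV[R]_3) : R :=
  cos (geodist p (center c)) / cos (radius c).

Definition laguerre_cell {R : realType} {n : nat} (c : 'I_n -> scircle R)
    (i : 'I_n) : set 'rV[R]_3 :=
  [set p | sphere2 p /\
    forall j : 'I_n, j != i -> laguerre_prox (c i) p > laguerre_prox (c j) p].

Definition nonempty_cells {R : realType} {n : nat} (c : 'I_n -> scircle R) :
    Prop :=
  forall i : 'I_n, laguerre_cell c i !=set0.

(* Main.v *)
Require Import Defs.
From mathcomp Require Import all_boot all_order all_algebra.
From mathcomp Require Import all_classical all_reals all_analysis.
From mathcomp Require Import ring lra.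

Import Order.TTheory GRing.Theory Num.Theory.
Local Open Scope classical_set_scope.
Local Open Scope ring_scope.

(** Put [r_i = 1 / cos (w_i)]. The proximity of [p] to the [i]-th circle is the
    scalar product of [p] with [v_i = r_i p_i], so [L_i] is nonempty as soon as
    [v_i] is an exposed point of the convex hull of the [v_j]. It thus suffices
    to find distinct points [v_i] of norm [r_i] on one common sphere. The sphere
    [k |v|^2 = v_z], of diameter [1 / k] and passing through the origin, has
    infinitely many points of each norm smaller than [1 / k]; the outward unit
    normal at [v] is [2 k v - e_z]. *)

Section Dot.
Context {R : realType}.
Implicit Types u v : 'rV[R]_3.

Lemma dotE u v : dot u v = u 0 0 * v 0 0 + u 0 1 * v 0 1 + u 0 2 * v 0 2.
Proof.
rewrite /dot !big_ord_recl big_ord0 addr0 addrA.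
by congr (_ + _ * _ + _ * _); congr (_ 0 _); apply/val_inj.
Qed.

Lemma dotZr (a : R) u v : dot u (a *: v) = a * dot u v.
Proof. by rewrite !dotE !mxE; ring. Qed.

Lemma dot_gt0 u : u != 0 -> 0 < dot u u.
Proof.
move=> u0; rewrite lt_neqAle sumr_ge0 ?andbT; last by move=> k _; exact: sqr_ge0.
apply: contra u0; rewrite eq_sym psumr_eq0; last by move=> k _; exact: sqr_ge0.
move=> /allP h; apply/eqP/rowP => k; rewrite mxE; apply/eqP.
by have := h k (mem_index_enum k); rewrite /= mulf_eq0 orbb.
Qed.

(** For unit vectors [|u + v|^2] and [|u - v|^2] are [2 + 2 u.v] and [2 - 2 u.v]. *)
Lemma dot_sphere2_itv u v : sphere2 u -> sphere2 v -> -1 <= dot u v <= 1.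
Proof.
rewrite /sphere2 /= !dotE => hu hv.
have := sqr_ge0 (u 0 0 + v 0 0); have := sqr_ge0 (u 0 0 - v 0 0).
have := sqr_ge0 (u 0 1 + v 0 1); have := sqr_ge0 (u 0 1 - v 0 1).
have := sqr_ge0 (u 0 2 + v 0 2); have := sqr_ge0 (u 0 2 - v 0 2).
by rewrite !expr2; lra.
Qed.

(** Makes the proximity linear in [u]: [cos] undoes [acos] on [[-1, 1]]. *)
Lemma laguerre_proxE (c : scircle R) u : sphere2 u ->
  laguerre_prox c u = dot u ((cos (Defs.radius c))^-1 *: Defs.center c).
Proof.
move=> hu; rewrite /laguerre_prox /geodist acosK ?dotZr 1?mulrC //.
by rewrite in_itv /= dot_sphere2_itv //; exact: center_sphere2.
Qed.

Definition sphere_normal (k : R) v := (2 * k) *: v - delta_mx 0 2.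

Lemma sphere2_normal k v : k * dot v v = v 0 2 -> sphere2 (sphere_normal k v).
Proof.
rewrite /sphere2 /= /sphere_normal => hv.
transitivity (1 + 4 * k * (k * dot v v - v 0 2)); last by rewrite hv; ring.
by rewrite !dotE !mxE /=; ring.
Qed.

(** On the sphere [k |v|^2 = v_z] the gap between the two sides is exactly [k |v - u|^2]. *)
Lemma sphere_normal_exposes k u v : 0 < k ->
  k * dot u u = u 0 2 -> k * dot v v = v 0 2 -> v != u ->
  dot (sphere_normal k u) v < dot (sphere_normal k u) u.
Proof.
move=> k0 hu hv vu; rewrite -subr_gt0.
suff -> : dot (sphere_normal k u) u - dot (sphere_normal k u) v =
    k * dot (v - u) (v - u) by rewrite mulr_gt0 // dot_gt0 // subr_eq0.
transitivity (k * dot (v - u) (v - u) +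
  (k * dot u u - u 0 2 - (k * dot v v - v 0 2))); last by rewrite hu hv; ring.
by rewrite !dotE !mxE /=; ring.
Qed.

End Dot.

Section Construction.
Context {R : realType}.

(* The point of norm [r] on the sphere [k |v|^2 = v_z] whose horizontal part
   points in the direction [(a, sqrt (1 - a^2))]. *)
Definition sphere_point (k r a : R) : 'rV[R]_3 :=
  let s := r * Num.sqrt (1 - (k * r) ^+ 2) in
  \row_j [:: s * a; s * Num.sqrt (1 - a ^+ 2); k * r ^+ 2]`_j.

Lemma dot_sphere_point k r a : (k * r) ^+ 2 <= 1 -> a ^+ 2 <= 1 ->
  dot (sphere_point k r a) (sphere_point k r a) = r ^+ 2.
Proof.
move=> hkr ha; rewrite dotE !mxE /=.
have := @sqr_sqrtr R (1 - (k * r) ^+ 2); rewrite subr_ge0 => /(_ hkr).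
have := @sqr_sqrtr R (1 - a ^+ 2); rewrite subr_ge0 => /(_ ha).
set b := Num.sqrt _ => hb; set q := Num.sqrt _ => hq.
transitivity (r ^+ 2 * q ^+ 2 * (a ^+ 2 + b ^+ 2) + (k * r ^+ 2) ^+ 2); first ring.
by rewrite hb hq; ring.
Qed.

(** The height [k r^2] determines [r]; then [k r < 1] keeps the horizontal radius nonzero, so the
    first coordinate determines [a]. *)
Lemma sphere_point_inj k r r' a a' : 0 < k -> 0 < r -> 0 < r' -> k * r < 1 ->
  sphere_point k r a = sphere_point k r' a' -> a = a'.
Proof.
move=> k0 r0 r'0 kr1 /rowP e.
have := e 2; rewrite !mxE /= => /(mulfI (lt0r_neq0 k0)) /eqP.
rewrite eqrXn2 ?ltW // => /eqP rr'; subst r'.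
have := e 0; rewrite !mxE /=; apply: mulfI.
by rewrite gt_eqF // mulr_gt0 // sqrtr_gt0 subr_gt0 expr_lt1 // mulr_ge0 // ltW.
Qed.

End Construction.

Theorem theorem4 (R : realType) (n : nat) (w : 'I_n -> R)
  (hw : forall i : 'I_n, 0 <= w i < pi / 2) :
  exists (p : 'I_n -> 'rV[R]_3) (hp : forall i : 'I_n, sphere2 (p i)),
    nonempty_cells (fun i : 'I_n => SCircle (p i) (w i) (hp i) (hw i)).
Proof.
have cos0 i : 0 < cos (w i).
  have /andP[w0 w1] := hw i; apply: cos_gt0_pihalf; rewrite w1 andbT.
  by apply: lt_le_trans w0; rewrite oppr_lt0 divr_gt0 ?pi_gt0.
pose r i := (cos (w i))^-1.
have r0 i : 0 < r i by rewrite invr_gt0.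
(* A product of factors in [(0, 1]] is at most each of them; halving gives [k < cos (w i)] strictly,
   for all [i] at once. *)
pose k : R := (\prod_i cos (w i)) / 2.
have k0 : 0 < k by rewrite divr_gt0 // prodr_gt0.
have kr1 i : k * r i < 1.
  rewrite ltr_pdivrMr // mul1r /k (bigD1 i) //=.
  have : \prod_(j < n | j != i) cos (w j) <= 1.
    by apply: prodr_ile1 => j; rewrite ltW //= cos_le1.
  by have := cos0 i; nra.
(* Distinct directions in [(0, 1]], so that circles of equal radius still get distinct points. *)
pose a (i : 'I_n) : R := i.+1%:R^-1.
have a1 i : a i ^+ 2 <= 1.
  by rewrite expr_le1 // ?invr_ge0 // invf_le1 ?ltr0n // ler1n.
have a_inj : injective a.
  by move=> i j /invr_inj /eqP; rewrite eqr_nat eqSS => /eqP /val_inj.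
pose v i := sphere_point k (r i) (a i).
have kr2 i : (k * r i) ^+ 2 <= 1.
  by rewrite expr_le1 ?ltW // mulr_gt0.
have dot_v i : dot (v i) (v i) = r i ^+ 2 by rewrite dot_sphere_point.
have v_sphere i : k * dot (v i) (v i) = v i 0 2 by rewrite dot_v !mxE.
have v_neq i j : j != i -> v j != v i.
  by apply: contra => /eqP /sphere_point_inj -/(_ k0 (r0 _) (r0 _) (kr1 _)) /a_inj ->.
pose p i := cos (w i) *: v i.
have hp i : sphere2 (p i).
  rewrite /sphere2 /= dotZr !dotE !mxE.
  transitivity (cos (w i) ^+ 2 * dot (v i) (v i)); first by rewrite dotE !mxE; ring.
  by rewrite dot_v -exprMn mulfV ?expr1n // gt_eqF.
(* The outward normal at [v i] is itself a point of the [i]-th cell. *)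
exists p, hp => i; exists (sphere_normal k (v i)).
have hn : sphere2 (sphere_normal k (v i)) by exact: sphere2_normal.
split=> // j ji; rewrite !laguerre_proxE //= !scalerA !mulVf ?gt_eqF // !scale1r.
by apply: sphere_normal_exposes => //; exact: v_neq.
Qed.
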